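(* Let $\phi\in\mathbf{FO}(\mathrm{NE},\sqcup)$. Then $\sim\phi$ is equivalent to some formula of $\mathbf{FO}(\mathrm{NE},\sqcup)$.
   Context: Team semantics (lax version). For a structure $\mathfrak M$ with domain $M$, a team $X$ is a (possibly empty) set of assignments $s:V\to M$, $V$ a finite set of variables. Satisfaction for formulas in negation normal form: first-order literal $\alpha$: every $s\in X$ satisfies $\alpha$ (Tarski); $\psi\vee\theta$: $X=Y\cup Z$ with $\mathfrak M\models_Y\psi$, $\mathfrak M\models_Z\theta$; $\psi\wedge\theta$: both; $\exists v\psi$: some $F:X\to\mathcal P(M)\setminus\{\emptyset\}$ with $\mathfrak M\models_{X[F/v]}\psi$, $X[F/v]=\{s[m/v]:s\in X,m\in F(s)\}$; $\forall v\psi$: $\mathfrak M\models_{X[M/v]}\psi$, $X[M/v]=\{s[m/v]:s\in X,m\in M\}$. $\mathfrak M\models_X\mathrm{NE}$ iff $X\ne\emptyset$; $\mathfrak M\models_X\phi\sqcup\psi$ iff $\mathfrak M\models_X\phi$ or $\mathfrak M\models_X\psi$; contradictory negation: $\mathfrak M\models_X\sim\phi$ iff $\mathfrak M\not\models_X\phi$. $\mathbf{FO}(\mathrm{NE},\sqcup)$ is first-order logic in negation normal form extended with $\mathrm{NE}$ and $\sqcup$. Two formulas are equivalent if satisfied by the same teams in all structures. *)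

(* Defs.v *)
(* Team semantics for FO(NE, sqcup), lax version.  Plain MathComp boot world. *)
From mathcomp Require Import all_boot.
Set Implicit Arguments. Unset Strict Implicit. Unset Printing Implicit Defensive.

Record signature := Signature {
  func : Type; farity : func -> nat;
  rel : Type; rarity : rel -> nat }.

Record structure (L : signature) := Structure {
  dom :> Type;
  dom_ne : inhabited dom;
  fint : forall f : func L, ('I_(farity f) -> dom) -> dom;
  rint : forall r : rel L, ('I_(rarity r) -> dom) -> Prop }.

Inductive term (L : signature) :=
  | Var of nat
  | App (f : func L) of ('I_(farity f) -> term L).

Inductive literal (L : signature) :=
  | LRel (r : rel L) of ('I_(rarity r) -> term L)
  | LNRel (r : rel L) of ('I_(rarity r) -> term L)
  | LEq of term L & term L
  | LNEq of term L & term L.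

Inductive formula (L : signature) :=
  | FLit of literal L
  | FAnd of formula L & formula L
  | FOr of formula L & formula L          (* tensor / split disjunction *)
  | FEx of nat & formula L
  | FAll of nat & formula L
  | FNE
  | FGor of formula L & formula L.        (* global disjunction  sqcup *)

Definition assignment (M : Type) := nat -> option M.
Definition team (M : Type) := assignment M -> Prop.
Definition is_team (M : Type) (V : seq nat) (X : team M) : Prop :=
  forall s, X s -> forall v, (s v <> None <-> v \in V).

Definition upd (M : Type) (s : assignment M) (v : nat) (m : M) : assignment M :=
  fun w => if w == v then Some m else s w.

Section Semantics.
Variables (L : signature) (M : structure L).

(* Term evaluation (relational; undefined if a variable is unassigned). *)
Inductive teval (s : assignment M) : term L -> M -> Prop :=
  | TEvar v m : s v = Some m -> teval s (Var L v) m
  | TEapp f (ts : 'I_(farity f) -> term L) (vs : 'I_(farity f) -> M) :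
      (forall i, teval s (ts i) (vs i)) -> teval s (App ts) (fint vs).

Definition lit_sat (s : assignment M) (l : literal L) : Prop :=
  match l with
  | LRel r ts => exists vs, (forall i, teval s (ts i) (vs i)) /\ rint vs
  | LNRel r ts => exists vs, (forall i, teval s (ts i) (vs i)) /\ ~ rint vs
  | LEq t1 t2 => exists a, teval s t1 a /\ teval s t2 a
  | LNEq t1 t2 => exists a b, teval s t1 a /\ teval s t2 b /\ a <> b
  end.

Definition supp_team (X : team M) (F : assignment M -> M -> Prop) (v : nat) : team M :=
  fun s' => exists s m, X s /\ F s m /\ s' = upd s v m.
Definition dup_team (X : team M) (v : nat) : team M :=
  fun s' => exists s m, X s /\ s' = upd s v m.

Fixpoint sat (X : team M) (phi : formula L) : Prop :=
  match phi with
  | FLit l => forall s, X s -> lit_sat s l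
  | FAnd a b => sat X a /\ sat X b
  | FOr a b => exists Y Z : team M,
      (forall s, X s <-> Y s \/ Z s) /\ sat Y a /\ sat Z b
  | FEx v a => exists F : assignment M -> M -> Prop,
      (forall s, X s -> exists m, F s m) /\ sat (supp_team X F v) a
  | FAll v a => sat (dup_team X v) a
  | FNE => exists s, X s
  | FGor a b => sat X a \/ sat X b
  end.

Definition sat_neg (X : team M) (phi : formula L) : Prop := ~ sat X phi.

End Semantics.

Fixpoint toccurs (L : signature) (v : nat) (t : term L) : Prop :=
  match t with
  | Var w => v = w
  | App f ts => exists i, toccurs v (ts i)
  end.

Definition loccurs (L : signature) (v : nat) (l : literal L) : Prop :=
  match l with
  | LRel r ts => exists i, toccurs v (ts i)
  | LNRel r ts => exists i, toccurs v (ts i)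
  | LEq t1 t2 => toccurs v t1 \/ toccurs v t2
  | LNEq t1 t2 => toccurs v t1 \/ toccurs v t2
  end.

Fixpoint free (L : signature) (v : nat) (phi : formula L) : Prop :=
  match phi with
  | FLit l => loccurs v l
  | FAnd a b | FOr a b | FGor a b => free v a \/ free v b
  | FEx w a | FAll w a => v <> w /\ free v a
  | FNE => False
  end.

(* Main.v *)
Require Import Defs.
From mathcomp Require Import all_boot.
From Stdlib Require Import Classical FunctionalExtensionality.
From Stdlib Require List.
Set Implicit Arguments. Unset Strict Implicit. Unset Printing Implicit Defensive.

(* Every formula of FO(NE, ⊔) is equivalent to a ⊔-disjunction of clauses
   α ∧ ⋀_j E β_j with α and the β_j first-order, where E β := (β ∧ NE) ∨ ⊤ holds
   in a team iff some assignment of the team satisfies β.  First-order formulas are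
   flat, and on assignments defining their free variables the dual formula (negation
   pushed down to the literals) is their classical negation.  So a team falsifies
   α ∧ ⋀_j E β_j iff it satisfies E (dual α) or one of the flat formulas dual β_j,
   and distributing ∧ over ⊔ turns the negation of a normal form into a normal form
   again. *)

Section TeamSemantics.
Variables (L : signature) (M : structure L).
Implicit Types (s : assignment M) (X Y Z : team M) (a b : formula L) (l : literal L).

Lemma teval_inv s t m : teval s t m ->
  match t with
  | Var v => s v = Some m
  | App f ts => exists vs, (forall i, teval s (ts i) (vs i)) /\ m = fint vs
  end.
Proof. by case=> [v m' Hv | f ts vs Hvs]; last exists vs. Qed.

Lemma teval_fun s t m1 m2 : teval s t m1 -> teval s t m2 -> m1 = m2.
Proof.
elim: t m1 m2 => [v | f ts IH] m1 m2 /teval_inv E1 /teval_inv E2.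
  by move: E2; rewrite E1 => -[].
case: E1 E2 => vs1 [H1 ->] [vs2 [H2 ->]]; congr fint.
by apply: functional_extensionality => i; apply: IH (H1 i) (H2 i).
Qed.

Lemma tevals_fun s n (ts : 'I_n -> term L) (vs1 vs2 : 'I_n -> M) :
  (forall i, teval s (ts i) (vs1 i)) -> (forall i, teval s (ts i) (vs2 i)) -> vs1 = vs2.
Proof.
by move=> H1 H2; apply: functional_extensionality => i; apply: teval_fun (H1 i) (H2 i).
Qed.

Lemma teval_exists s t : (forall v, toccurs v t -> s v <> None) -> exists m, teval s t m.
Proof.
elim: t => [v | f ts IH] Hdef.
  case E: (s v) => [m|]; first by exists m; constructor.
  by case: (Hdef v).
have /fin_all_exists [vs Hvs] : forall i, exists m, teval s (ts i) m.
  by move=> i; apply: IH => v Hv; apply: Hdef; exists i.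
by exists (fint vs); constructor.
Qed.

Lemma tevals_exists s n (ts : 'I_n -> term L) :
  (forall v, (exists i, toccurs v (ts i)) -> s v <> None) ->
  exists vs, forall i, teval s (ts i) (vs i).
Proof.
move=> Hdef; have /fin_all_exists // : forall i, exists m, teval s (ts i) m.
by move=> i; apply: teval_exists => v Hv; apply: Hdef; exists i.
Qed.

Lemma lit_sat_rel s r (ts : 'I_(rarity r) -> term L) vs :
  (forall i, teval s (ts i) (vs i)) -> lit_sat s (LRel ts) <-> rint vs.
Proof.
move=> Hvs; split=> [[vs' [Hvs' Hr]] | Hr]; last by exists vs.
by rewrite (tevals_fun Hvs Hvs').
Qed.

Lemma lit_sat_nrel s r (ts : 'I_(rarity r) -> term L) vs :
  (forall i, teval s (ts i) (vs i)) -> lit_sat s (LNRel ts) <-> ~ rint vs.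
Proof.
move=> Hvs; split=> [[vs' [Hvs' Hr]] | Hr]; last by exists vs.
by rewrite (tevals_fun Hvs Hvs').
Qed.

Lemma lit_sat_eq s t1 t2 m1 m2 :
  teval s t1 m1 -> teval s t2 m2 -> lit_sat s (LEq t1 t2) <-> m1 = m2.
Proof.
move=> H1 H2; split=> [[m [Hm1 Hm2]] | E]; last by exists m1; rewrite {2}E.
by rewrite (teval_fun H1 Hm1) (teval_fun H2 Hm2).
Qed.

Lemma lit_sat_neq s t1 t2 m1 m2 :
  teval s t1 m1 -> teval s t2 m2 -> lit_sat s (LNEq t1 t2) <-> m1 <> m2.
Proof.
move=> H1 H2; split=> [[n1 [n2 [Hn1 [Hn2 Hn]]]] | Hm]; last by exists m1, m2.
by rewrite (teval_fun H1 Hn1) (teval_fun H2 Hn2).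
Qed.

Definition dual_lit l : literal L :=
  match l with
  | LRel r ts => LNRel ts
  | LNRel r ts => LRel ts
  | LEq t1 t2 => LNEq t1 t2
  | LNEq t1 t2 => LEq t1 t2
  end.

(* Coverage matters: a literal with an unassigned variable fails together with its dual. *)
Lemma lit_sat_dual s l : (forall v, loccurs v l -> s v <> None) ->
  lit_sat s (dual_lit l) <-> ~ lit_sat s l.
Proof.
case: l => [r ts | r ts | t1 t2 | t1 t2] Hdef.
- have [vs Hvs] := tevals_exists Hdef.
  by rewrite (lit_sat_nrel Hvs) (lit_sat_rel Hvs).
- have [vs Hvs] := tevals_exists Hdef.
  rewrite (lit_sat_nrel Hvs) (lit_sat_rel Hvs).
  by split=> [Hr /(_ Hr) | /NNPP].
- have [m1 H1] := teval_exists (fun v Hv => Hdef v (or_introl Hv)).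
  have [m2 H2] := teval_exists (fun v Hv => Hdef v (or_intror Hv)).
  by rewrite (lit_sat_neq H1 H2) (lit_sat_eq H1 H2).
- have [m1 H1] := teval_exists (fun v Hv => Hdef v (or_introl Hv)).
  have [m2 H2] := teval_exists (fun v Hv => Hdef v (or_intror Hv)).
  rewrite (lit_sat_neq H1 H2) (lit_sat_eq H1 H2).
  by split=> [E /(_ E) | /NNPP].
Qed.

Definition sat1 s a := sat (fun t => t = s) a.
Definition flat a := forall X, sat X a <-> forall s, X s -> sat1 s a.

Lemma sat1_lit s l : sat1 s (FLit l) <-> lit_sat s l.
Proof. by split=> [/(_ s erefl) | H _ ->]. Qed.

Lemma sat1_and s a b : sat1 s (FAnd a b) <-> sat1 s a /\ sat1 s b.
Proof. by []. Qed.

Lemma sat1_or s a b : flat a -> flat b -> sat1 s (FOr a b) <-> sat1 s a \/ sat1 s b.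
Proof.
move=> Fa Fb; split.
  case=> Y [Z [HYZ [/Fa Ha /Fb Hb]]].
  by case: ((HYZ s).1 erefl) => [/Ha | /Hb]; [left | right].
case=> H.
  exists (fun t => t = s), (fun _ => False); split; first by move=> t; tauto.
  by split=> //; apply/Fb.
exists (fun _ => False), (fun t => t = s); split; first by move=> t; tauto.
by split=> //; apply/Fa.
Qed.

Lemma sat1_ex s v a : flat a -> sat1 s (FEx v a) <-> exists m, sat1 (upd s v m) a.
Proof.
move=> Fa; split.
  case=> F [HF /Fa Ha]; have [m Hm] := HF s erefl.
  by exists m; apply: Ha; exists s, m.
case=> m Hm; exists (fun _ m' => m' = m); split; first by move=> t _; exists m.
by apply/Fa => s' [t [m' [-> [-> ->]]]].
Qed.

Lemma sat1_all s v a : flat a -> sat1 s (FAll v a) <-> forall m, sat1 (upd s v m) a.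
Proof.
move=> Fa; split=> [/Fa H m | H]; first by apply: H; exists s, m.
by apply/Fa => s' [t [m [-> ->]]].
Qed.

Lemma flat_lit l : flat (FLit l).
Proof. by move=> X; split=> H s Hs; apply/sat1_lit; apply: H. Qed.

Lemma flat_and a b : flat a -> flat b -> flat (FAnd a b).
Proof.
move=> Fa Fb X /=; rewrite Fa Fb.
split=> [[Ha Hb] s Hs | H]; first by split; [apply: Ha | apply: Hb].
by split=> s /H [].
Qed.

Lemma flat_or a b : flat a -> flat b -> flat (FOr a b).
Proof.
move=> Fa Fb X; split.
  case=> Y [Z [HYZ [/Fa Ha /Fb Hb]]] s /HYZ [/Ha | /Hb] H;
    apply/(sat1_or _ Fa Fb); by [left | right].
move=> H; exists (fun s => X s /\ sat1 s a), (fun s => X s /\ sat1 s b); split.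
  move=> s; split=> [Hs | ]; last tauto.
  by move: (H s Hs) => /(sat1_or _ Fa Fb); tauto.
by split; [apply/Fa => s [] | apply/Fb => s []].
Qed.

Lemma flat_ex v a : flat a -> flat (FEx v a).
Proof.
move=> Fa X; split.
  case=> F [HF /Fa Ha] s Hs; apply/(sat1_ex _ _ Fa); have [m Hm] := HF s Hs.
  by exists m; apply: Ha; exists s, m.
move=> H; exists (fun s m => sat1 (upd s v m) a); split.
  by move=> s /H /(sat1_ex _ _ Fa).
by apply/Fa => s' [s [m [_ [Hm ->]]]].
Qed.

Lemma flat_all v a : flat a -> flat (FAll v a).
Proof.
move=> Fa X; split.
  by move=> /Fa H s Hs; apply/(sat1_all _ _ Fa) => m; apply: H; exists s, m.
move=> H; apply/Fa => s' [s [m [Hs ->]]].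
by have /(sat1_all _ _ Fa) := H s Hs.
Qed.

Fixpoint first_order a : Prop :=
  match a with
  | FLit _ => True
  | FAnd a b | FOr a b => first_order a /\ first_order b
  | FEx _ a | FAll _ a => first_order a
  | FNE | FGor _ _ => False
  end.

Lemma first_order_flat a : first_order a -> flat a.
Proof.
elim: a => [l|a IHa b IHb|a IHa b IHb|v a IH|v a IH| |a IHa b IHb] //=.
- by move=> _; apply: flat_lit.
- by case=> /IHa Fa /IHb Fb; apply: flat_and.
- by case=> /IHa Fa /IHb Fb; apply: flat_or.
- by move=> /IH; apply: flat_ex.
- by move=> /IH; apply: flat_all.
Qed.

Fixpoint dual a : formula L :=
  match a with
  | FLit l => FLit (dual_lit l)
  | FAnd a b => FOr (dual a) (dual b)
  | FOr a b => FAnd (dual a) (dual b)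
  | FEx v a => FAll v (dual a)
  | FAll v a => FEx v (dual a)
  | FNE => FNE L
  | FGor a b => FGor a b
  end.

Lemma first_order_dual a : first_order a -> first_order (dual a).
Proof. by elim: a => //= [a IHa b IHb|a IHa b IHb] [/IHa ? /IHb ?]. Qed.

Definition covers s a := forall v, free v a -> s v <> None.

Lemma covers_and s a b : covers s (FAnd a b) -> covers s a /\ covers s b.
Proof. by move=> Hc; split=> v Hv; apply: Hc; [left | right]. Qed.

Lemma covers_upd s v m a : covers s (FAll v a) -> covers (upd s v m) a.
Proof. by move=> Hc w Hw; rewrite /upd; case: eqP => // Hwv; apply: Hc. Qed.

Lemma sat1_dual a s : first_order a -> covers s a -> sat1 s (dual a) <-> ~ sat1 s a.
Proof.
elim: a s => [l|a IHa b IHb|a IHa b IHb|v a IH|v a IH| |a IHa b IHb] //= s.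
- by move=> _ Hc; rewrite !sat1_lit; apply: lit_sat_dual.
- case=> Fa Fb /covers_and [Ca Cb].
  have Fda := first_order_flat (first_order_dual Fa).
  have Fdb := first_order_flat (first_order_dual Fb).
  rewrite (sat1_or _ Fda Fdb) sat1_and (IHa _ Fa Ca) (IHb _ Fb Cb).
  by have := classic (sat1 s a); tauto.
- case=> Fa Fb /covers_and [Ca Cb].
  rewrite sat1_and (sat1_or _ (first_order_flat Fa) (first_order_flat Fb)).
  by rewrite (IHa _ Fa Ca) (IHb _ Fb Cb); tauto.
- move=> Fa Hc; have IHm m := IH (upd s v m) Fa (covers_upd Hc).
  rewrite (sat1_all _ _ (first_order_flat (first_order_dual Fa))).
  rewrite (sat1_ex _ _ (first_order_flat Fa)).
  split=> [H [m Hm] | H m]; first exact: (IHm m).1 (H m) Hm.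
  by apply/IHm => Hm; apply: H; exists m.
- move=> Fa Hc; have IHm m := IH (upd s v m) Fa (covers_upd Hc).
  rewrite (sat1_ex _ _ (first_order_flat (first_order_dual Fa))).
  rewrite (sat1_all _ _ (first_order_flat Fa)).
  split=> [[m Hm] H | H]; first exact: (IHm m).1 Hm (H m).
  by have [m Hm] := not_all_ex_not _ _ H; exists m; apply/IHm.
Qed.

Definition top : formula L := FAll 0 (FLit (LEq (Var L 0) (Var L 0))).
Definition bot : formula L := FAnd (FNE L) (FLit (LNEq (Var L 0) (Var L 0))).

Lemma sat_top X : sat X top.
Proof. by move=> _ [s [m [_ ->]]]; exists m; split; constructor; rewrite /upd eqxx. Qed.

Lemma sat_bot X : ~ sat X bot.
Proof. by case=> [[s Hs] /(_ s Hs) [m1 [m2 [H1 [H2]]]]]; apply; apply: teval_fun H1 H2. Qed.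

Record clause := Clause { body : formula L; witnesses : list (formula L) }.

Definition sat_clause X p :=
  (forall s, X s -> sat1 s (body p)) /\
  (forall b, List.In b (witnesses p) -> exists s, X s /\ sat1 s b).
Definition sat_nf X N := exists p, List.In p N /\ sat_clause X p.

Definition clause_on (P : formula L -> Prop) p :=
  P (body p) /\ forall b, List.In b (witnesses p) -> P b.
Definition nf_on (P : formula L -> Prop) N := forall p, List.In p N -> clause_on P p.

Definition nf_prod (f : clause -> clause -> clause) N1 N2 :=
  List.flat_map (fun p => List.map (f p) N2) N1.

Lemma in_nf_prod f N1 N2 r : List.In r (nf_prod f N1 N2) <->
  exists p q, List.In p N1 /\ List.In q N2 /\ r = f p q.
Proof.
rewrite /nf_prod List.in_flat_map.
split=> [[p [Hp /List.in_map_iff [q [<- Hq]]]] | [p [q [Hp [Hq ->]]]]].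
  by exists p, q.
by exists p; split=> //; apply/List.in_map_iff; exists q.
Qed.

Definition clause_and p q :=
  Clause (FAnd (body p) (body q)) (List.app (witnesses p) (witnesses q)).

Lemma sat_clause_and X p q :
  sat_clause X (clause_and p q) <-> sat_clause X p /\ sat_clause X q.
Proof.
rewrite /sat_clause /=; split.
  case=> Hbody Hwit; split; split=> [s /Hbody [] // | b Hb];
    apply: Hwit; apply/List.in_app_iff; by [left | right].
case=> [[Hp Wp] [Hq Wq]]; split=> [s Hs | b /List.in_app_iff [/Wp | /Wq] //].
by split; [apply: Hp | apply: Hq].
Qed.

Lemma sat_nf_and X N1 N2 :
  sat_nf X (nf_prod clause_and N1 N2) <-> sat_nf X N1 /\ sat_nf X N2.
Proof.
split=> [[r [/in_nf_prod [p [q [Hp [Hq ->]]]] /sat_clause_and [Sp Sq]]] | ].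
  by split; [exists p | exists q].
case=> [[p [Hp Sp]] [q [Hq Sq]]]; exists (clause_and p q).
by split; [apply/in_nf_prod; exists p, q | apply/sat_clause_and].
Qed.

(* Guarding each witness by the body of its clause lets a split of the team be read off
   assignment by assignment. *)
Definition clause_or p q :=
  Clause (FOr (body p) (body q))
    (List.app (List.map (FAnd (body p)) (witnesses p))
              (List.map (FAnd (body q)) (witnesses q))).

Lemma sat_clause_or X p q : first_order (body p) -> first_order (body q) ->
  sat_clause X (clause_or p q) <->
  exists Y Z, (forall s, X s <-> Y s \/ Z s) /\ sat_clause Y p /\ sat_clause Z q.
Proof.
move=> /first_order_flat Fp /first_order_flat Fq; split.
  case=> /= Hbody Hwit.
  exists (fun s => X s /\ sat1 s (body p)), (fun s => X s /\ sat1 s (body q)).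
  split=> [s | ].
    split=> [Hs | ]; last tauto.
    by move: (Hbody s Hs) => /(sat1_or _ Fp Fq); tauto.
  split; split=> [s [] // | b Hb].
  - have [|s [Hs [Hsp Hsb]]] := Hwit (FAnd (body p) b).
      by apply/List.in_app_iff; left; apply/List.in_map_iff; exists b.
    by exists s.
  - have [|s [Hs [Hsq Hsb]]] := Hwit (FAnd (body q) b).
      by apply/List.in_app_iff; right; apply/List.in_map_iff; exists b.
    by exists s.
case=> Y [Z [HYZ [[Yp Wp] [Zq Wq]]]]; split=> /= [s /HYZ [/Yp | /Zq] H | ].
- by apply/(sat1_or _ Fp Fq); left.
- by apply/(sat1_or _ Fp Fq); right.
move=> _ /List.in_app_iff [] /List.in_map_iff [b [<- Hb]].
- have [s [Hs Hsb]] := Wp b Hb.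
  by exists s; split; [apply/HYZ; left | split=> //; apply: Yp].
- have [s [Hs Hsb]] := Wq b Hb.
  by exists s; split; [apply/HYZ; right | split=> //; apply: Zq].
Qed.

Definition clause_ex v p :=
  Clause (FEx v (body p)) (List.map (fun b => FEx v (FAnd (body p) b)) (witnesses p)).

Lemma sat_clause_ex X v p : clause_on first_order p ->
  sat_clause X (clause_ex v p) <->
  exists F, (forall s, X s -> exists m, F s m) /\ sat_clause (supp_team X F v) p.
Proof.
case=> /first_order_flat Fp Fw; split.
  case=> /= Hbody Hwit; exists (fun s m => sat1 (upd s v m) (body p)); split.
    by move=> s /Hbody /(sat1_ex _ _ Fp).
  split=> [s' [s [m [_ [Hm ->]]]] // | b Hb].
  have Fpb : flat (FAnd (body p) b) := flat_and Fp (first_order_flat (Fw b Hb)).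
  have [|s [Hs /(sat1_ex _ _ Fpb) [m [Hm Hmb]]]] := Hwit (FEx v (FAnd (body p) b)).
    by apply/List.in_map_iff; exists b.
  by exists (upd s v m); split=> //; exists s, m.
case=> F [HF [Hbody Hwit]]; split=> /= [s Hs | _ /List.in_map_iff [b [<- Hb]]].
  have [m Hm] := HF s Hs; apply/(sat1_ex _ _ Fp); exists m.
  by apply: Hbody; exists s, m.
have Fpb : flat (FAnd (body p) b) := flat_and Fp (first_order_flat (Fw b Hb)).
have [_ [[s [m [Hs [Hm ->]]]] Hb']] := Hwit b Hb.
exists s; split=> //; apply/(sat1_ex _ _ Fpb); exists m; split=> //.
by apply: Hbody; exists s, m.
Qed.

Definition clause_all v p := Clause (FAll v (body p)) (List.map (FEx v) (witnesses p)).

Lemma sat_clause_all X v p : clause_on first_order p ->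
  sat_clause X (clause_all v p) <-> sat_clause (dup_team X v) p.
Proof.
case=> /first_order_flat Fp Fw; split.
  case=> /= Hbody Hwit; split=> [s' [s [m [Hs ->]]] | b Hb].
    exact: (sat1_all _ _ Fp).1 (Hbody s Hs) m.
  have [|s [Hs /(sat1_ex _ _ (first_order_flat (Fw b Hb))) [m Hm]]] := Hwit (FEx v b).
    by apply/List.in_map_iff; exists b.
  by exists (upd s v m); split=> //; exists s, m.
case=> Hbody Hwit; split=> /= [s Hs | _ /List.in_map_iff [b [<- Hb]]].
  by apply/(sat1_all _ _ Fp) => m; apply: Hbody; exists s, m.
have [_ [[s [m [Hs ->]]] Hb']] := Hwit b Hb.
by exists s; split=> //; apply/(sat1_ex _ _ (first_order_flat (Fw b Hb))); exists m.
Qed.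

Fixpoint nf phi : list clause :=
  match phi with
  | FLit l => [:: Clause (FLit l) [::]]
  | FAnd a b => nf_prod clause_and (nf a) (nf b)
  | FOr a b => nf_prod clause_or (nf a) (nf b)
  | FEx v a => List.map (clause_ex v) (nf a)
  | FAll v a => List.map (clause_all v) (nf a)
  | FNE => [:: Clause top [:: top]]
  | FGor a b => List.app (nf a) (nf b)
  end.

Lemma nf_first_order phi : nf_on first_order (nf phi).
Proof.
elim: phi => [l|a IHa b IHb|a IHa b IHb|v a IH|v a IH| |a IHa b IHb] p /=.
- by case=> [<- | []]; split=> // b [].
- move=> /in_nf_prod [p1 [q [H1 [H2 ->]]]].
  have [A1 B1] := IHa p1 H1; have [A2 B2] := IHb q H2.
  by split=> [// | c /List.in_app_iff [/B1 | /B2]].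
- move=> /in_nf_prod [p1 [q [H1 [H2 ->]]]].
  have [A1 B1] := IHa p1 H1; have [A2 B2] := IHb q H2.
  split=> [// | c /List.in_app_iff [] /List.in_map_iff [w [<- Hw]]].
  + by split; [| apply: B1].
  + by split; [| apply: B2].
- move=> /List.in_map_iff [q [<- Hq]]; have [A B] := IH q Hq.
  by split=> // c /List.in_map_iff [w [<- Hw]]; split; [| apply: B].
- move=> /List.in_map_iff [q [<- Hq]]; have [A B] := IH q Hq.
  by split=> // c /List.in_map_iff [w [<- Hw]] /=; apply: B.
- by case=> [<- | []]; split=> // w [<- | []] //.
- by move=> /List.in_app_iff [/IHa | /IHb].
Qed.

Lemma sat_nfP X phi : sat X phi <-> sat_nf X (nf phi).
Proof.
have Fo a p : List.In p (nf a) -> first_order (body p) := fun Hp => (nf_first_order Hp).1.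
elim: phi X => [l|a IHa b IHb|a IHa b IHb|v a IH|v a IH| |a IHa b IHb] X /=.
- split=> [H | [_ [[<- | []] [H _]]] s Hs]; last exact/sat1_lit/H.
  by exists (Clause (FLit l) [::]); split; [left | split=> [s /H /sat1_lit | b []]].
- by rewrite IHa IHb sat_nf_and.
- split=> [[Y [Z [HYZ [/IHa [p [Hp Sp]] /IHb [q [Hq Sq]]]]]] | ].
    exists (clause_or p q); split; first by apply/in_nf_prod; exists p, q.
    by apply/(sat_clause_or _ (Fo _ _ Hp) (Fo _ _ Hq)); exists Y, Z.
  case=> _ [/in_nf_prod [p [q [Hp [Hq ->]]]]].
  move=> /(sat_clause_or _ (Fo _ _ Hp) (Fo _ _ Hq)) [Y [Z [HYZ [Sp Sq]]]].
  by exists Y, Z; split=> //; split; [apply/IHa; exists p | apply/IHb; exists q].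
- split=> [[F [HF /IH [p [Hp Sp]]]] | [_ [/List.in_map_iff [p [<- Hp]]]]].
    exists (clause_ex v p); split; first by apply/List.in_map_iff; exists p.
    by apply/(sat_clause_ex _ _ (nf_first_order Hp)); exists F.
  move=> /(sat_clause_ex _ _ (nf_first_order Hp)) [F [HF Sp]].
  by exists F; split=> //; apply/IH; exists p.
- rewrite IH; split=> [[p [Hp Sp]] | [_ [/List.in_map_iff [p [<- Hp]]]]].
    exists (clause_all v p); split; first by apply/List.in_map_iff; exists p.
    exact/(sat_clause_all _ _ (nf_first_order Hp)).
  by move=> /(sat_clause_all _ _ (nf_first_order Hp)) Sp; exists p.
- split=> [[s Hs] | [_ [[<- | []] [_ /(_ top (or_introl erefl)) [s [Hs _]]]]]];
    last by exists s.
  exists (Clause top [:: top]); split; first by left.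
  split=> [t _ | _ [<- | []]]; first exact: sat_top.
  by exists s; split=> //; apply: sat_top.
- rewrite IHa IHb.
  split=> [[[p [Hp Sp]] | [p [Hp Sp]]] | [p [/List.in_app_iff [Hp | Hp] Sp]]].
  + by exists p; split=> //; apply/List.in_app_iff; left.
  + by exists p; split=> //; apply/List.in_app_iff; right.
  + by left; exists p.
  + by right; exists p.
Qed.

Lemma free_top v : ~ free v top.
Proof. by case=> Hv []. Qed.

Definition free_in (phi : formula L) a := forall v, free v a -> free v phi.

Lemma nf_free phi : nf_on (free_in phi) (nf phi).
Proof.
elim: phi => [l|a IHa b IHb|a IHa b IHb|v a IH|v a IH| |a IHa b IHb] p /=.
- by case=> [<- | []]; split=> // w [].
- move=> /in_nf_prod [p1 [q [H1 [H2 ->]]]].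
  have [A1 B1] := IHa p1 H1; have [A2 B2] := IHb q H2.
  split=> [u [/A1 | /A2] | c /List.in_app_iff [/B1 | /B2] Hc u /Hc]; by [left | right].
- move=> /in_nf_prod [p1 [q [H1 [H2 ->]]]].
  have [A1 B1] := IHa p1 H1; have [A2 B2] := IHb q H2.
  split=> [u [/A1 | /A2] | c]; [by left | by right | ].
  move=> /List.in_app_iff [] /List.in_map_iff [w [<- Hw]] u [].
  + by move=> /A1; left.
  + by move=> /(B1 _ Hw); left.
  + by move=> /A2; right.
  + by move=> /(B2 _ Hw); right.
- move=> /List.in_map_iff [q [<- Hq]]; have [A B] := IH q Hq.
  by split=> [u [Huv /A] | _ /List.in_map_iff [w [<- Hw]] u [Huv [/A | /(B _ Hw)]]].
- move=> /List.in_map_iff [q [<- Hq]]; have [A B] := IH q Hq.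
  by split=> [u [Huv /A] | _ /List.in_map_iff [w [<- Hw]] u [Huv /(B _ Hw)]].
- by case=> [<- | []]; split=> [u /free_top [] | _ [<- | []] u /free_top []].
- move=> /List.in_app_iff [/IHa | /IHb] [A B] /=; split=> [u /A | c /B Hc u /Hc];
    by [left | right].
Qed.

Definition team_covers X a := forall s, X s -> covers s a.

Lemma nf_team_covers V X phi : is_team V X -> (forall v, free v phi -> v \in V) ->
  nf_on (team_covers X) (nf phi).
Proof.
move=> HX Hphi p /nf_free [A B].
have cover a : free_in phi a -> team_covers X a.
  by move=> Ha s Hs v /Ha /Hphi /(HX s Hs v).2.
by split=> [| b /B]; apply: cover.
Qed.

Lemma nf_on_cons P p N : nf_on P (p :: N) <-> clause_on P p /\ nf_on P N.
Proof.
split=> [H | [Hp HN] q [<- | /HN]] //.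
by split=> [| q Hq]; apply: H; [left | right].
Qed.

Lemma sat_nf_cons X p N : sat_nf X (p :: N) <-> sat_clause X p \/ sat_nf X N.
Proof.
split=> [[q [[<- | Hq] Sq]] | [Sp | [q [Hq Sq]]]].
- by left.
- by right; exists q.
- by exists p; split=> //; left.
- by exists q; split=> //; right.
Qed.

Definition clause_neg p : list clause :=
  Clause top [:: dual (body p)] :: List.map (fun b => Clause (dual b) [::]) (witnesses p).

Fixpoint nf_neg N : list clause :=
  match N with
  | [::] => [:: Clause top [::]]
  | p :: N => nf_prod clause_and (clause_neg p) (nf_neg N)
  end.

Lemma sat_clause_neg X p : clause_on first_order p -> clause_on (team_covers X) p ->
  ~ sat_clause X p <-> sat_nf X (clause_neg p).
Proof.
case=> Fbody Fwit [Cbody Cwit]; split=> [Hn | ].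
  case: (classic (forall s, X s -> sat1 s (body p))) => [Hbody | ].
    have Hnwit : ~ forall b, List.In b (witnesses p) -> exists s, X s /\ sat1 s b.
      by move=> Hwit; apply: Hn.
    have [b Hb'] := not_all_ex_not _ _ Hnwit.
    have [Hb Hnb] := imply_to_and _ _ Hb'.
    exists (Clause (dual b) [::]); split; first by right; apply/List.in_map_iff; exists b.
    split=> [s Hs | _ []] /=; apply/(sat1_dual (Fwit b Hb) (Cwit b Hb s Hs)) => Hsb.
    by apply: Hnb; exists s.
  move=> /not_all_ex_not [s Hs'].
  have [Hs Hns] := imply_to_and _ _ Hs'.
  exists (Clause top [:: dual (body p)]); split; first by left.
  split=> [t _ | _ [<- | []]]; first exact: sat_top.
  by exists s; split=> //; apply/(sat1_dual Fbody (Cbody s Hs)).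
case=> _ [[<- | /List.in_map_iff [b [<- Hb]]] [Hbody Hwit]] [Sbody Swit].
  have [s [Hs]] := Hwit _ (or_introl erefl).
  by move/(sat1_dual Fbody (Cbody s Hs)); apply; apply: Sbody.
have [s [Hs Hsb]] := Swit b Hb.
by move: (Hbody s Hs) => /(sat1_dual (Fwit b Hb) (Cwit b Hb s Hs)); apply.
Qed.

Lemma sat_nf_neg X N : nf_on first_order N -> nf_on (team_covers X) N ->
  ~ sat_nf X N <-> sat_nf X (nf_neg N).
Proof.
elim: N => [|p N IH] FN CN.
  split=> [_ | _ [_ [[] _]]]; exists (Clause top [::]); split; first by left.
  by split=> [s _ | _ []]; first exact: sat_top.
case/nf_on_cons: FN => Fp FN; case/nf_on_cons: CN => Cp CN.
by rewrite sat_nf_and -(sat_clause_neg Fp Cp) -(IH FN CN) sat_nf_cons; tauto.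
Qed.

Lemma nf_neg_first_order N : nf_on first_order N -> nf_on first_order (nf_neg N).
Proof.
elim: N => [_ | p N IH /nf_on_cons [[Fbody Fwit] /IH FN]] q.
  by case=> [<- | []]; split=> // w [].
move=> /in_nf_prod [p1 [q1 [Hp1 [Hq1 ->]]]].
have [A2 B2] := FN q1 Hq1.
have [A1 B1] : clause_on first_order p1.
  case: Hp1 => [<- | /List.in_map_iff [b [<- Hb]]].
    by split=> // w [<- | []]; apply: first_order_dual.
  by split=> [| w []] /=; apply: first_order_dual; apply: Fwit.
by split=> [| w /List.in_app_iff [/B1 | /B2]].
Qed.

Definition some_sat b := FOr (FAnd b (FNE L)) top.

Fixpoint witness_fml bs : formula L :=
  if bs is b :: bs then FAnd (some_sat b) (witness_fml bs) else top.

Definition clause_fml p := FAnd (body p) (witness_fml (witnesses p)).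

Fixpoint nf_fml N : formula L :=
  if N is p :: N then FGor (clause_fml p) (nf_fml N) else bot.

Lemma sat_some_sat X b : first_order b -> sat X (some_sat b) <-> exists s, X s /\ sat1 s b.
Proof.
move=> /first_order_flat Fb; split.
  case=> Y [Z [HYZ [[/Fb Yb [s Hs]] _]]].
  by exists s; split; [apply/HYZ; left | apply: Yb].
case=> s [Hs Hsb]; exists (fun t => t = s), X; split.
  by move=> t; split=> [Ht | [-> | Ht]] //; right.
by split; [split; [| exists s] | apply: sat_top].
Qed.

Lemma sat_witness_fml X bs : (forall b, List.In b bs -> first_order b) ->
  sat X (witness_fml bs) <-> forall b, List.In b bs -> exists s, X s /\ sat1 s b.
Proof.
elim: bs => [_ | b bs IH Fbs]; first by split=> [_ _ [] | _]; last exact: sat_top.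
have Fb := Fbs b (or_introl erefl).
have {}IH := IH (fun c Hc => Fbs c (or_intror Hc)).
split=> [[/(sat_some_sat _ Fb) Hb /IH Hbs] c [<- | /Hbs] // | H].
by split; [apply/(sat_some_sat _ Fb) | apply/IH => c Hc]; apply: H; [left | right].
Qed.

Lemma sat_clause_fml X p : clause_on first_order p -> sat X (clause_fml p) <-> sat_clause X p.
Proof.
case=> /first_order_flat Fbody Fwit.
by rewrite /clause_fml /= Fbody (sat_witness_fml _ Fwit).
Qed.

Lemma sat_nf_fml X N : nf_on first_order N -> sat X (nf_fml N) <-> sat_nf X N.
Proof.
elim: N => [_ | p N IH /nf_on_cons [Fp /IH {}IH]].
  by split=> [/sat_bot [] | [_ [[] _]]].
by rewrite sat_nf_cons -(sat_clause_fml _ Fp) -IH.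
Qed.

End TeamSemantics.

Theorem mainTheorem6 (L : signature) (phi : formula L) :
  exists psi : formula L,
    forall (M : structure L) (V : seq nat) (X : team M),
      is_team V X ->
      (forall v, free v phi \/ free v psi -> v \in V) ->
      (sat_neg X phi <-> sat X psi).
Proof.
exists (nf_fml (nf_neg (nf phi))) => M V X HX Hfree.
have Fnf := nf_first_order (phi:=phi).
have Cnf := nf_team_covers HX (fun v Hv => Hfree v (or_introl Hv)).
rewrite /sat_neg sat_nfP (sat_nf_neg Fnf Cnf).
by rewrite sat_nf_fml //; apply: nf_neg_first_order.
Qed.
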